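(* Every quandle $X$ has a unique maximal connected subquandle decomposition; that is, there is exactly one decomposition $X=\bigsqcup_{i\in I}A_i$ of $X$ (as a disjoint union, up to re-indexing) in which every $A_i$ is a maximal connected subquandle of $X$.
   Context: A quandle is a non-empty set $X$ with a binary operation $*$ such that (i) $a*a=a$ for all $a$; (ii) for every $a\in X$ the map $S_a:X\to X$, $S_a(x)=x*a$, is a bijection; (iii) $(a*b)*c=(a*c)*(b*c)$ for all $a,b,c$. A subquandle is a non-empty subset that is itself a quandle under $*$. The inner automorphism group $\mathrm{Inn}(X)$ is the group of bijections of $X$ generated by $\{S_a\mid a\in X\}$. A quandle $X$ is connected if $\mathrm{Inn}(X)$ acts transitively on $X$. A connected subquandle of $X$ is a subquandle $A$ which is connected as a quandle in its own right (i.e. $\mathrm{Inn}(A)$, computed in the quandle $A$, acts transitively on $A$). A connected subquandle $A$ of $X$ is a maximal connected subquandle of $X$ if the only connected subquandle of $X$ including $A$ is $A$ itself. $X=\bigsqcup_{i\in I}A_i$ is called the maximal connected subquandle decomposition of $X$ when each $A_i$ is a maximal connected subquandle of $X$. *)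

(* Defs.v *)
(* MathComp world: sets and classical logic from mathcomp-classical. *)
From mathcomp Require Import all_boot.
From mathcomp Require Import boolp classical_sets.

Set Implicit Arguments.
Unset Strict Implicit.
Unset Printing Implicit Defensive.

Local Open Scope classical_set_scope.

Definition right_translation (X : Type) (op : X -> X -> X) (a x : X) : X :=
  op x a.

Record is_quandle (X : Type) (op : X -> X -> X) : Prop := IsQuandle {
  quandle_inhabited : inhabited X;
  quandle_idem : forall a, op a a = a;
  quandle_bij : forall a, bijective (right_translation op a);
  quandle_dist : forall a b c, op (op a b) c = op (op a c) (op b c)
}.

Record is_bijection_group (X : Type) (G : set (X -> X)) : Prop :=
  IsBijectionGroup {
    bijection_group_bij : forall f, G f -> bijective f;
    bijection_group_id : G id;
    bijection_group_comp : forall f g, G f -> G g -> G (f \o g);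
    bijection_group_inv :
      forall f g, G f -> cancel f g -> cancel g f -> G g
  }.

(* [smallest] is an intersection, hence everything if no bijection group
   contains the translations; this does not occur when [op] is a quandle
   operation, as all bijections of X then form such a group. *)
Definition Inn (X : Type) (op : X -> X -> X) : set (X -> X) :=
  smallest (@is_bijection_group X) (range (right_translation op)).

Definition connected (X : Type) (op : X -> X -> X) : Prop :=
  forall x y, exists2 f, Inn op f & f x = y.

Definition op_closed (X : Type) (op : X -> X -> X) (A : set X) : Prop :=
  forall a b, A a -> A b -> A (op a b).

(* A set coerces to the type of its elements, so this is an operation on the
   subtype carved out by A. *)
Definition restr_op (X : Type) (op : X -> X -> X) (A : set X)
    (clA : op_closed op A) (a b : A) : A :=
  SigSub (mem_set (clA _ _ (set_valP a) (set_valP b))).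

Definition subquandle (X : Type) (op : X -> X -> X) (A : set X) : Prop :=
  exists clA : op_closed op A, is_quandle (restr_op clA).

(* Inn is computed in the quandle A, not in X. *)
Definition connected_subquandle (X : Type) (op : X -> X -> X) (A : set X) :
    Prop :=
  subquandle op A /\ exists clA : op_closed op A, connected (restr_op clA).

Definition maximal_connected_subquandle (X : Type) (op : X -> X -> X)
    (A : set X) : Prop :=
  connected_subquandle op A /\
  forall B, connected_subquandle op B -> A `<=` B -> B = A.

Definition maximal_connected_decomposition (X : Type) (op : X -> X -> X)
    (I : Type) (A : I -> set X) : Prop :=
  partition [set: I] A [set: X] /\
  forall i, maximal_connected_subquandle op (A i).

(* Main.v *)
(* Two points of X are linked by a subset U when a chain of translations S_u
   and S_u^-1 with u in U leads from one to the other.  Given x, let U be the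
   union of {x} and of all connected subquandles containing x; every point of U
   is linked to x by U.  The class of points linked to x by U is closed under
   the operation, since S_{g x} = g S_x g^-1 for g in the group generated by the
   S_u; it is therefore a connected subquandle, and it contains every connected
   subquandle through x.  Hence each point lies in exactly one maximal connected
   subquandle, and these are the only possible blocks. *)
Require Import Defs.
From Stdlib Require Import Relation_Operators.
From mathcomp Require Import all_boot.
From mathcomp Require Import boolp classical_sets.

Set Implicit Arguments.
Unset Strict Implicit.
Unset Printing Implicit Defensive.

Local Open Scope classical_set_scope.

(** The symmetric closure supplies the steps by S_u^-1 without naming an inverse operation. *)
Definition linked (X : Type) (op : X -> X -> X) (U : set X) : X -> X -> Prop :=
  clos_refl_sym_trans X (fun a b => exists2 u, U u & b = op a u).

Section Linked.
Variables (X : Type) (op : X -> X -> X).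
Implicit Types (U A B : set X) (x y z : X).

Lemma linked_refl U x : linked op U x x.
Proof. exact: rst_refl. Qed.

Lemma linked_sym U x y : linked op U x y -> linked op U y x.
Proof. exact: rst_sym. Qed.

Lemma linked_trans U y x z :
  linked op U x y -> linked op U y z -> linked op U x z.
Proof. exact: rst_trans. Qed.

Lemma linked_op U x u : U u -> linked op U x (op x u).
Proof. by move=> Uu; apply: rst_step; exists u. Qed.

Lemma linkedS U A x y : U `<=` A -> linked op U x y -> linked op A x y.
Proof.
move=> UA; elim=> [a _ [u Uu ->]|a|a b _|a b c _ ab _].
- exact/linked_op/UA.
- exact: linked_refl.
- exact: linked_sym.
- exact: linked_trans.
Qed.

Lemma Inn_id : Inn op id.
Proof. by move=> G [[]]. Qed.

Lemma Inn_comp f g : Inn op f -> Inn op g -> Inn op (f \o g).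
Proof.
by move=> If Ig G GP; case: (GP) => -[_ _ + _] _; apply; [apply: If|apply: Ig].
Qed.

Lemma Inn_inv f g : Inn op f -> cancel f g -> cancel g f -> Inn op g.
Proof.
move=> If fg gf G GP; case: (GP) => -[_ _ _ +] _; apply; [|exact: fg|by []].
exact: If.
Qed.

Lemma Inn_translation a : Inn op (right_translation op a).
Proof. by move=> G [_]; apply; exists a. Qed.

Hypothesis opQ : is_quandle op.

Lemma op_div b x : exists y, op y b = x.
Proof. by case: (quandle_bij opQ b) => g _ gK; exists (g x); exact: gK. Qed.

Lemma opI b x y : op x b = op y b -> x = y.
Proof. exact: (bij_inj (quandle_bij opQ b)). Qed.

(** Trades transitivity of the group for chains of translations, on which one can argue by
    induction. *)
Lemma connectedP : connected op <-> forall x y, linked op setT x y.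
Proof.
split=> [con x y|lnk x y].
  have [f If <-] := con x y.
  (* The bijections moving every point within its class form a group containing the translations, so
     this group contains [Inn op]. *)
  pose G : set (X -> X) :=
    [set h | bijective h /\ forall z, linked op setT z (h z)].
  suff /(_ f If) [_ +] : Inn op `<=` G by apply.
  apply: smallest_sub => [|_ [a _ <-]]; last first.
    by split=> [|z]; [exact: (quandle_bij opQ)|exact: linked_op].
  split=> [h []//||h k [bh lh] [bk lk]|h k [bh lh] hk kh].
  - by split=> [|z]; [exists id|exact: linked_refl].
  - split=> [|z]; first exact: bij_comp.
    exact: linked_trans (lk z) (lh _).
  - split=> [|z]; first by exists h.
    by apply: linked_sym; rewrite -{2}(kh z).
elim: (lnk x y) => {x y lnk} [a _ [u _ ->]|a|a b _ [f If <-]|].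
- by exists (right_translation op u) => //; exact: Inn_translation.
- by exists id => //; exact: Inn_id.
(* Reversing a link calls for the inverse of [f]. *)
- have [g fg gf] : bijective f.
    suff /(_ f If) : Inn op `<=` [set h | bijective h] by [].
    apply: smallest_sub => [|_ [c _ <-]]; last exact: (quandle_bij opQ).
    split=> [h //||h k|h k _ hk kh]; [by exists id|exact: bij_comp|by exists h].
  by exists g => //; exact: Inn_inv If fg gf.
- move=> a b c _ [f If <-] _ [g Ig <-].
  by exists (g \o f) => //; exact: Inn_comp.
Qed.

(* The translation by a point moves within classes iff the translations by all
   linked points do, because S_{b * u} = S_u S_b S_u^-1. *)
Lemma linked_translation U b c : linked op U b c ->
  (forall x, linked op U x (op x b)) <-> (forall x, linked op U x (op x c)).
Proof.
elim=> [{}b _ [u Uu ->]|//|{}b {}c _ [? ?] //|]; last first.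
  by move=> {}b d {}c _ [bd db] _ [dc cd]; split=> [/bd|/cd].
split=> lnk x.
  (* For x = y * u, distributivity gives x * (b * u) = (y * b) * u, which is reached from x through
     y and y * b. *)
  have [y <-] := op_div u x; rewrite -(quandle_dist opQ).
  apply: (linked_trans (linked_sym (linked_op y Uu))).
  exact: linked_trans (lnk y) (linked_op _ Uu).
apply: (linked_trans (linked_op x Uu)); apply: (linked_trans (lnk _)).
by rewrite -(quandle_dist opQ); apply/linked_sym/linked_op.
Qed.

End Linked.

Section Components.
Variables (X : Type) (op : X -> X -> X).
Hypothesis opQ : is_quandle op.
Implicit Types (A B U : set X) (x : X).

Lemma linked_val A (clA : op_closed op A) (a b : A) :
  linked (restr_op clA) setT a b -> linked op A (val a) (val b).
Proof.
elim=> [{}a _ [u _ ->]|{}a|{}a {}b _|{}a {}b c _ ab _].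
- exact/linked_op/set_valP.
- exact: linked_refl.
- exact: linked_sym.
- exact: linked_trans.
Qed.

(** Closure under the operation and under division keeps a chain of translations by points of [A]
    inside [A] once it starts there. *)
Lemma linked_restr A (clA : op_closed op A) :
  (forall x a, A a -> A (op x a) -> A x) ->
  forall a b : A, linked op A (val a) (val b) ->
  linked (restr_op clA) setT a b.
Proof.
move=> divA a b; move: (erefl (val b)) (erefl (val a)).
move: {1 3}(val a) {1 3}(val b) => x y + + lnk.
(* Membership in [A] is carried through the induction so that the middle point of a composite chain
   lifts to the subtype. *)
suff [_ +] : (A x <-> A y) /\ forall a b : A, val a = x -> val b = y ->
  linked (restr_op clA) setT a b by move=> + by_ ax; apply.
elim: lnk => {x y a b} [x _ [u Au ->]|x|x y _ [xy lnk]|].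
- split=> [|a b ax bxu]; first by split=> [Ax|]; [exact: clA|exact: divA].
  have -> : b = restr_op clA a (SigSub (mem_set Au)).
    by apply: val_inj; rewrite /= ax.
  exact: linked_op.
- by split=> // a b <- /val_inj ->; exact: linked_refl.
- split=> [|a b ay bx]; first by split=> /xy.
  exact/linked_sym/lnk.
- move=> x y z _ [xy lxy] _ [yz lyz].
  split=> [|a b ax bz]; first by split=> [/xy/yz|/yz/xy].
  have Ay : A y by apply/xy; rewrite -ax; exact: set_valP.
  by apply: (@linked_trans _ _ _ (SigSub (mem_set Ay))); [apply: lxy|apply: lyz].
Qed.

Lemma restr_quandle A (clA : op_closed op A) : A !=set0 ->
  (forall x a, A a -> A (op x a) -> A x) -> is_quandle (restr_op clA).
Proof.
move=> [x0 Ax0] divA; split.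
- by constructor; exact: (SigSub (mem_set Ax0)).
- by move=> a; apply: val_inj; exact: (quandle_idem opQ).
- move=> a; have [g opK gK] := quandle_bij opQ (val a).
  have Ag (b : A) : A (g (val b)).
    apply: (divA _ (val a)); first exact: set_valP.
    by rewrite -/(right_translation op _ _) gK; exact: set_valP.
  by exists (fun b => SigSub (mem_set (Ag b))) => b;
    apply: val_inj; [exact: opK|exact: gK].
- by move=> a b c; apply: val_inj; exact: (quandle_dist opQ).
Qed.

(** Restates the notion inside X, free of subtypes; closure under division expresses that each S_a
    with a in [A] maps [A] onto itself. *)
Lemma connected_subquandleP A : connected_subquandle op A <->
  [/\ A !=set0, op_closed op A,
      (forall x a, A a -> A (op x a) -> A x) &
      (forall x y, A x -> A y -> linked op A x y)].
Proof.
split=> [[[clA AQ] [clA' con]]|[A0 clA divA lnk]]; last first.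
  have AQ := restr_quandle clA A0 divA.
  split; exists clA => //; apply/(connectedP AQ) => a b.
  by apply: linked_restr => //; apply: lnk; exact: set_valP.
rewrite (Prop_irrelevance clA' clA) in con.
split=> //.
- by have [a] := quandle_inhabited AQ; exists (val a); exact: set_valP.
- move=> x a Aa Axa.
  (* Surjectivity of S_a on [A] gives y in [A] with y * a = x * a; injectivity of S_a on X then
     gives y = x. *)
  have [y /(congr1 val)/= yxa] :=
    op_div AQ (SigSub (mem_set Aa)) (SigSub (mem_set Axa)).
  by rewrite -(opI opQ yxa); exact: set_valP.
- move=> x y Ax Ay; move/(connectedP AQ): con.
  by move=> /(_ (SigSub (mem_set Ax)) (SigSub (mem_set Ay)))/linked_val.
Qed.

Lemma connected_subquandle_class U x : U x ->
  (forall u, U u -> linked op U x u) ->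
  connected_subquandle op [set y | linked op U x y].
Proof.
move=> Ux Ulnk.
(* Translation by x preserves classes because x is in [U]; this passes along the chain from x to
   b. *)
have tr b z : linked op U x b -> linked op U z (op z b).
  move=> xb; move: z; apply/(linked_translation opQ xb) => z.
  exact: linked_op.
apply/connected_subquandleP; split=> [|a b xa xb|a b xb xab|a b xa xb] /=.
- by exists x; exact: linked_refl.
- exact: linked_trans xa (tr _ _ xb).
- exact: linked_trans xab (linked_sym (tr _ _ xb)).
(* [U] lies in the class, so a chain through [U] is a chain through the class. *)
- apply: (linkedS Ulnk); exact: linked_trans (linked_sym xa) xb.
Qed.

Lemma greatest_connected_subquandle x : exists Q : set X,
  [/\ connected_subquandle op Q, Q x &
      forall A, connected_subquandle op A -> A x -> A `<=` Q].
Proof.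
(* Putting in x itself makes [U x] immediate, as [connected_subquandle_class] requires. *)
pose U : set X := [set u | u = x \/
  exists A, [/\ connected_subquandle op A, A x & A u]].
have Ulnk u : U u -> linked op U x u.
  move=> [->|[A [conA Ax Au]]]; first exact: linked_refl.
  have /connected_subquandleP[_ _ _ /(_ x u Ax Au)] := conA.
  by apply: linkedS => a Aa; right; exists A.
exists [set y | linked op U x y]; split.
- by apply: connected_subquandle_class => //; left.
- exact: linked_refl.
- by move=> A conA Ax u Au; apply: Ulnk; right; exists A.
Qed.

Lemma maximal_connected_subquandle_cover x :
  exists2 Q, maximal_connected_subquandle op Q & Q x.
Proof.
have [Q [conQ Qx Qmax]] := greatest_connected_subquandle x.
exists Q => //; split=> // B conB QB.
by apply/seteqP; split=> //; apply: Qmax => //; exact: QB.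
Qed.

(** Both coincide with the greatest connected subquandle through x. *)
Lemma maximal_connected_subquandle_eq A B x :
  maximal_connected_subquandle op A -> maximal_connected_subquandle op B ->
  A x -> B x -> A = B.
Proof.
move=> [conA Amax] [conB Bmax] Ax Bx.
have [Q [conQ _ Qmax]] := greatest_connected_subquandle x.
by rewrite -(Amax Q conQ (Qmax A conA Ax)) (Bmax Q conQ (Qmax B conB Bx)).
Qed.

Lemma maximal_connected_subquandle_neq0 A :
  maximal_connected_subquandle op A -> A !=set0.
Proof. by case=> /connected_subquandleP[]. Qed.

(** A point of a block [B j] lies in some block of [A], and maximal blocks that meet are equal. *)
Lemma maximal_connected_decomposition_reindex (I J : Type)
    (A : I -> set X) (B : J -> set X) :
  maximal_connected_decomposition op A -> maximal_connected_decomposition op B ->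
  exists f : J -> I, forall j, A (f j) = B j.
Proof.
move=> [[covA _ _] Amax] [_ Bmax].
suff /choice[f] : forall j, exists i, A i = B j by exists f.
move=> j; have [x Bx] := maximal_connected_subquandle_neq0 (Bmax j).
have [i _ Ax] : cover [set: I] A x by rewrite covA.
by exists i; exact: maximal_connected_subquandle_eq Ax Bx.
Qed.

Lemma maximal_connected_decomposition_inj (I : Type) (A : I -> set X) :
  maximal_connected_decomposition op A -> injective A.
Proof.
move=> [[_ triv ne] _] i j Aij; apply: triv => //.
by rewrite Aij setIid; exact: ne.
Qed.

End Components.

Theorem theorem2 (X : Type) (op : X -> X -> X) (hX : is_quandle op) :
  exists (I : Type) (A : I -> set X),
    maximal_connected_decomposition op A /\
    forall (J : Type) (B : J -> set X),
      maximal_connected_decomposition op B ->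
      exists2 f : J -> I, bijective f & forall j, A (f j) = B j.
Proof.
(* The maximal connected subquandles index themselves. *)
pose A (Q : [set Q | maximal_connected_subquandle op Q]) : set X := val Q.
have Adec : maximal_connected_decomposition op A.
  split=> [|Q]; last exact: set_valP.
  split=> [|P Q _ _ [x [Px Qx]]|Q _].
  - apply/seteqP; split=> // x _.
    have [Q Qmax Qx] := maximal_connected_subquandle_cover hX x.
    by exists (SigSub (mem_set Qmax)).
  - apply/val_inj/(maximal_connected_subquandle_eq hX _ _ Px Qx);
      exact: set_valP.
  - by apply: (maximal_connected_subquandle_neq0 hX); exact: set_valP.
exists _, A; split=> // J B Bdec.
have [f fE] := maximal_connected_decomposition_reindex hX Adec Bdec.
have [g gE] := maximal_connected_decomposition_reindex hX Bdec Adec.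
(* The reindexings in the two directions are mutually inverse, since both families are injective. *)
exists f => //; exists g => [j|Q].
- by apply: (maximal_connected_decomposition_inj Bdec); rewrite gE fE.
- by apply: (maximal_connected_decomposition_inj Adec); rewrite fE gE.
Qed.
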